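(* For an integer $n\ge 3$ let $C_n$ denote the cycle graph on $n$ vertices, and let $\chi_d^{\min}(C_n)$ be the minimum of $\chi_d(D)$ over all orientations $D$ of $C_n$. Write $n=4k-i$ with $k$ a positive integer and $i\in\{0,1,2,3\}$. Then $\chi_d^{\min}(C_n)=k+2$, with the exceptions $\chi_d^{\min}(C_4)=2$ and $\chi_d^{\min}(C_5)=\chi_d^{\min}(C_6)=3$.
   Context: All digraphs are orientations of simple graphs (no loops, at most one arc between two vertices). For a digraph $D$ and $v\in V(D)$, $N^+(v)=\{u: vu\in A(D)\}$. A dominator coloring of $D$ is a partition of $V(D)$ into color classes such that (i) it is a proper coloring of the underlying graph (adjacent vertices receive different colors), and (ii) every vertex $v$ with at least one out-neighbor dominates some color class, i.e., there is a color class $C$ with $C\subseteq N^+(v)$; vertices of out-degree $0$ are not required to dominate anything. $\chi_d(D)$ is the minimum number of color classes in a dominator coloring of $D$. *)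

(* Defs.v *)
From mathcomp Require Import all_boot.

Set Implicit Arguments.
Unset Strict Implicit.
Unset Printing Implicit Defensive.

(* A digraph on a finite vertex type [T] is its set of arcs. *)
Definition digraph (T : finType) := {set T * T}.

Section Digraphs.
Variable T : finType.
Implicit Types (D : digraph T) (P : {set {set T}}) (e : rel T).

Definition out_nbr D (v : T) : {set T} := [set u | (v, u) \in D].

Definition underlying D : rel T :=
  [rel x y | ((x, y) \in D) || ((y, x) \in D)].

Definition proper_coloring e P : bool :=
  partition P [set: T] &&
  [forall C in P, forall x in C, forall y in C, ~~ e x y].

Definition dominates D (v : T) (C : {set T}) : bool := C \subset out_nbr D v.

Definition dominator_coloring D P : bool :=
  proper_coloring (underlying D) P &&
  [forall v, (out_nbr D v != set0) ==> [exists C in P, dominates D v C]].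

(* The value [#|T|] used for an empty range is never a spurious minimum: in a
   digraph with no loops the partition into singletons is a dominator coloring
   (see [chi_d_attained]), and no partition has more than [#|T|] classes. *)
Definition chi_d D : nat :=
  \big[minn/#|T|]_(P : {set {set T}} | dominator_coloring D P) #|P|.

Definition orientation e D : bool :=
  [forall x, forall y,
     (underlying D x y == e x y) && ~~ (((x, y) \in D) && ((y, x) \in D))].

(* As above, [#|T|] plays no role: see [chi_d_min_attained]. *)
Definition chi_d_min e : nat :=
  \big[minn/#|T|]_(D : digraph T | orientation e D) chi_d D.

End Digraphs.

(* [ordS] is the cyclic successor i |-> i + 1 mod n; this is the cycle C_n
   for n >= 3. *)
Definition cycle_graph (n : nat) : rel 'I_n :=
  [rel x y | (y == ordS x) || (x == ordS y)].
Arguments cycle_graph n : clear implicits.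

Lemma bigminn_le (I : finType) (Q : pred I) (F : I -> nat) m i :
  Q i -> \big[minn/m]_(j | Q j) F j <= F i.
Proof.
move=> Qi; rewrite unlock /reducebig.
have: i \in index_enum I by rewrite mem_index_enum.
elim: (index_enum I) => //= a s IHs; rewrite inE => /orP[/eqP <-|/IHs le_s].
  by rewrite Qi geq_minl.
by case: ifP => // _; apply: leq_trans (geq_minr _ _) le_s.
Qed.

Lemma bigminn_attained (I : finType) (Q : pred I) (F : I -> nat) m i :
  Q i -> F i <= m -> exists2 j, Q j & \big[minn/m]_(j | Q j) F j = F j.
Proof.
move=> Qi le_im; have le_min := bigminn_le F m Qi.
have [Hm|//] : \big[minn/m]_(j | Q j) F j = m \/
               exists2 j, Q j & \big[minn/m]_(j | Q j) F j = F j.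
  apply: (big_ind (fun x => x = m \/ exists2 j, Q j & x = F j)) => [|x y Hx Hy|j Qj].
  - by left.
  - by rewrite /minn; case: ifP.
  - by right; exists j.
by exists i => //; apply/eqP; rewrite eqn_leq le_min Hm.
Qed.

Section Sanity.
Variable T : finType.
Implicit Types (D : digraph T) (P : {set {set T}}) (e : rel T).

Lemma card_coloring e P : proper_coloring e P -> #|P| <= #|T|.
Proof.
case/andP=> /and3P[/eqP covP trivP nP0] _.
rewrite -cardsT -covP -(eqP trivP) -sum1_card; apply: leq_sum => C PC.
by rewrite card_gt0; apply: contraNneq nP0 => <-.
Qed.

Lemma discrete_dominator D :
  (forall x, (x, x) \notin D) -> dominator_coloring D [set [set x] | x : T].
Proof.
move=> D_irr; apply/andP; split; first (apply/andP; split).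
- apply/and3P; split.
  + apply/eqP/setP=> x; rewrite inE; apply/bigcupP.
    by exists [set x]; rewrite ?set11 ?imset_f.
  + apply/trivIsetP=> _ _ /imsetP[x _ ->] /imsetP[y _ ->] xy.
    by rewrite disjoints1 inE; apply: contraNneq xy => ->.
  + by apply/imsetP=> -[x _ /setP/(_ x)]; rewrite !inE eqxx.
- apply/forall_inP=> _ /imsetP[a _ ->].
  apply/forall_inP=> x /set1P->; apply/forall_inP=> y /set1P->.
  by rewrite /underlying /= orbb D_irr.
- apply/forallP=> v; apply/implyP=> /set0Pn[u vu].
  by apply/exists_inP; exists [set u]; rewrite ?imset_f // /dominates sub1set.
Qed.

Lemma chi_d_le D P : dominator_coloring D P -> chi_d D <= #|P|.
Proof. exact: bigminn_le. Qed.

Lemma chi_d_attained D : (forall x, (x, x) \notin D) ->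
  exists2 P, dominator_coloring D P & chi_d D = #|P|.
Proof.
move=> /discrete_dominator domD; apply: (bigminn_attained domD).
by case/andP: domD => /card_coloring.
Qed.

Lemma orientation_irr e D x : orientation e D -> (x, x) \notin D.
Proof. by move/forallP/(_ x)/forallP/(_ x)/andP=> [_]; rewrite andbb. Qed.

Lemma orientation_exists e : irreflexive e -> symmetric e ->
  exists D, orientation e D.
Proof.
move=> e_irr e_sym.
exists [set p | e p.1 p.2 && (enum_rank p.1 < enum_rank p.2)].
apply/forallP=> x; apply/forallP=> y; rewrite /underlying /= !inE /= (e_sym y x).
case exy: (e x y) => //=; case: ltngtP => // /ord_inj/enum_rank_inj xy.
by rewrite xy e_irr in exy.
Qed.

Lemma chi_d_min_le e D : orientation e D -> chi_d_min e <= chi_d D.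
Proof. exact: bigminn_le. Qed.

Lemma chi_d_min_attained e : irreflexive e -> symmetric e ->
  exists2 D, orientation e D & chi_d_min e = chi_d D.
Proof.
move=> e_irr e_sym; have [D oD] := orientation_exists e_irr e_sym.
apply: (bigminn_attained oD).
have [x|P domP ->] := @chi_d_attained D; first exact: orientation_irr oD.
by case/andP: domP => /card_coloring.
Qed.

End Sanity.

(* Main.v *)
Require Import Defs.
From mathcomp Require Import all_boot.
From mathcomp Require Import zify.

Set Implicit Arguments.
Unset Strict Implicit.
Unset Printing Implicit Defensive.

(** Lower bound: fix an orientation of C_n and a dominator coloring, and let q
    be the number of dominated classes and r the number of other classes.  Sinks
    are independent and so are the classes, so there are at most n/2 sinks and
    at most n/2 vertices in each class.  A dominated class C is a singleton,
    dominated by at most two vertices, or (if n <> 4) a pair of vertices at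
    distance 2, dominated by one vertex only; in both cases #|C| plus the number
    of vertices dominating C is at most 3.  Double counting gives
    n - n/2 <= 2q and (n - n/2) + (n - r * (n/2)) <= 3q.
    Upper bound: let odd vertices be sources, except that for odd n the last
    vertex points to 0; give a private color to each multiple of 4, a common
    color to the odd vertices and another one to the remaining vertices. *)

(** * Upper bounds from explicit colorings *)

Lemma chi_d_min_le_coloring (T : finType) (m : nat) (e : rel T) (D : digraph T)
    (f : T -> 'I_m) :
  orientation e D ->
  (forall x y, e x y -> f x != f y) ->
  (forall v, out_nbr D v != set0 ->
     exists w, forall x, f x = f w -> (v, x) \in D) ->
  chi_d_min e <= m.
Proof.
move=> oD f_proper f_dom.
have eD x y : underlying D x y = e x y.
  by move/forallP/(_ x)/forallP/(_ y)/andP: oD => [/eqP].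
set P := preim_partition f [set: T].
have partP : partition P [set: T] by apply: preim_partitionP.
have PE : P = [set [set y | f x == f y] | x : T].
  rewrite /P /preim_partition /equivalence_partition.
  apply/setP=> C; apply/imsetP/imsetP=> -[x _ ->]; exists x => //;
  by apply/setP=> y; rewrite !inE.
have domP : dominator_coloring D P.
  apply/andP; split; first (apply/andP; split=> //).
    rewrite PE; apply/forall_inP=> _ /imsetP[a _ ->].
    apply/forall_inP=> x; rewrite inE => /eqP ax.
    apply/forall_inP=> y; rewrite inE => /eqP ay.
    by rewrite eD; apply/negP=> /f_proper; rewrite -ax -ay eqxx.
  apply/forallP=> v; apply/implyP=> /f_dom[w w_dom].
  apply/exists_inP; exists [set y | f w == f y].
    by rewrite PE; apply/imsetP; exists w.
  by apply/subsetP=> x; rewrite !inE => /eqP xw; apply: w_dom.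
apply: leq_trans (chi_d_min_le oD) (leq_trans (chi_d_le domP) _).
have -> : P = [set [set y | c == f y] | c in f @: [set: T]].
  rewrite PE -imset_comp.
  by apply/setP=> C; apply/imsetP/imsetP=> -[x _ ->]; exists x.
by apply: leq_trans (leq_imset_card _ _) _; rewrite -[leqRHS]card_ord max_card.
Qed.

Lemma cycle_graphE n (x y : 'I_n) :
  cycle_graph n x y = (val y == x.+1 %% n) || (val x == y.+1 %% n).
Proof. by []. Qed.

Lemma modS n j : j < n -> j.+1 %% n = if j.+1 == n then 0 else j.+1.
Proof.
move=> jn; case: eqP => [->|nj]; first by rewrite modnn.
by rewrite modn_small //; lia.
Qed.

Lemma cycle_graph_irr n : 1 < n -> irreflexive (cycle_graph n).
Proof.
move=> n_gt1 x; rewrite cycle_graphE modS //; case: x => x /= xn.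
by case: ifP; lia.
Qed.

Lemma cycle_graph_sym n : symmetric (cycle_graph n).
Proof. by move=> x y; rewrite /cycle_graph /= orbC. Qed.

(** For odd [n] the edge between [n - 1] and 0 joins two even vertices; the last disjunct orients
    it. *)
Definition odd_source n : digraph 'I_n :=
  [set p : 'I_n * 'I_n | cycle_graph n p.1 p.2 &&
     (odd p.1 && ~~ odd p.2 || (p.1.+1 == n) && (val p.2 == 0))].

Lemma odd_source_arc n (x y : 'I_n) : ((x, y) \in odd_source n) =
  cycle_graph n x y && (odd x && ~~ odd y || (x.+1 == n) && (val y == 0)).
Proof. by rewrite inE. Qed.

Lemma odd_source_orientation n :
  2 < n -> orientation (cycle_graph n) (odd_source n).
Proof.
move=> n_gt2; apply/forallP=> x; apply/forallP=> y.
rewrite /underlying /= !odd_source_arc (cycle_graph_sym y x).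
rewrite cycle_graphE !modS //; case: x y => x xn [y yn] /=.
by do ?case: ifP; lia.
Qed.

Lemma chi_d_min_le_odd_source (n m : nat) (f : 'I_n -> 'I_m) : 2 < n ->
  (forall x y, cycle_graph n x y -> f x != f y) ->
  (forall v : 'I_n, odd v || (v.+1 == n) ->
     exists w, forall x, f x = f w -> (v, x) \in odd_source n) ->
  chi_d_min (cycle_graph n) <= m.
Proof.
move=> n_gt2 f_proper f_dom.
apply: chi_d_min_le_coloring (odd_source_orientation n_gt2) f_proper _.
move=> v /set0Pn[u]; rewrite inE odd_source_arc => /andP[_ vu].
by apply: f_dom; case/orP: vu => /andP[-> _]; rewrite ?orbT.
Qed.

Lemma chi_d_min_cycle_le n k : 2 < n -> n <= 4 * k -> 4 * k <= n + 3 ->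
  chi_d_min (cycle_graph n) <= k + 2.
Proof.
move=> n_gt2 n_le n_ge.
pose g j := if odd j then k else if j %% 4 == 2 then k.+1 else j %/ 4.
have g_lt (j : 'I_n) : g j < k + 2.
  by case: j => j jn; rewrite /g /=; do ?case: ifP; lia.
apply: (@chi_d_min_le_odd_source _ _ (fun j => Ordinal (g_lt j))) => //.
  move=> x y; apply: contraTneq => /(congr1 val).
  rewrite cycle_graphE !modS //=.
  case: x y => x xn [y yn] /=; rewrite /g.
  by do ?case: ifP; lia.
move=> v v_dom.
(* The class dominated by [v] is the singleton of an adjacent multiple of 4: the predecessor if [v]
   is 1 mod 4, otherwise the successor, which is 0 when [v] is the last vertex. *)
have w_lt : (if v %% 4 == 1 then v.-1 else v.+1 %% n) < n.
  by rewrite modS //; case: v v_dom => v vn /=; do ?case: ifP; lia.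
exists (Ordinal w_lt) => x /(congr1 val) /=.
rewrite odd_source_arc cycle_graphE !modS // /g.
case: v x v_dom {w_lt} => v vn [x xn] /=.
by do ?case: ifP; rewrite ?mod0n ?div0n /=; lia.
Qed.

(** Color by parity: in C_4 each odd vertex points to both even ones. *)
Lemma chi_d_min_cycle4_le : chi_d_min (cycle_graph 4) <= 2.
Proof.
have g_lt (j : 'I_4) : odd j < 2 by case: (odd j).
apply: (@chi_d_min_le_odd_source _ _ (fun j => Ordinal (g_lt j))) => //.
  move=> x y; apply: contraTneq => /(congr1 val) /=.
  by case: x y => [[|[|[|[|x]]]] xn] [[|[|[|[|y]]]] yn].
move=> v v_dom; exists ord0 => x /(congr1 val) /=.
rewrite odd_source_arc cycle_graphE.
by case: v x v_dom => [[|[|[|[|v]]]] vn] [[|[|[|[|x]]]] xn].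
Qed.

Lemma chi_d_min_cycle56_le n :
  4 < n < 7 -> chi_d_min (cycle_graph n) <= 3.
Proof.
move=> n_bounds.
pose g j := if odd j then 1 else if j == 0 then 0 else 2.
have g_lt (j : 'I_n) : g j < 3 by rewrite /g; do ?case: ifP.
apply: (@chi_d_min_le_odd_source _ _ (fun j => Ordinal (g_lt j))); first lia.
  move=> x y; apply: contraTneq => /(congr1 val).
  rewrite cycle_graphE !modS //=.
  case: x y => x xn [y yn] /=; rewrite /g.
  by do ?case: ifP; lia.
move=> v v_dom.
(* Vertex 3 dominates the class {2, 4}; vertices 1 and [n - 1] dominate {0}. *)
have w_lt : (if val v == 3 then 2 else 0) < n by case: ifP; lia.
exists (Ordinal w_lt) => x /(congr1 val) /=.
rewrite odd_source_arc cycle_graphE !modS // /g.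
case: v x v_dom {w_lt} => v vn [x xn] /=.
by do ?case: ifP; rewrite /=; lia.
Qed.

(** * Lower bound by double counting *)

Lemma card_independent_cycle n (U : {set 'I_n}) :
  {in U &, forall x y, ~~ cycle_graph n x y} -> #|U| <= n./2.
Proof.
move=> indU.
(* An independent set and its shift by one are disjoint and of equal size. *)
have disjU : [disjoint U & @ordS n @: U].
  apply/pred0P=> y /=; apply/negbTE/andP=> -[yU /imsetP[x xU yE]].
  by have := indU x y xU yU; rewrite /cycle_graph /= yE eqxx.
have := max_card (mem (U :|: @ordS n @: U)).
rewrite card_ord cardsU disjoint_setI0 // cards0 subn0.
by rewrite (card_imset _ (@ordS_inj n)) addnn geq_half_double.
Qed.

Lemma cycle_graphP n (x y : 'I_n) :
  cycle_graph n x y = (y \in [set ordS x; ord_pred x]).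
Proof.
rewrite /cycle_graph /= !inE; congr (_ || _).
by apply/eqP/eqP=> ->; rewrite ?ordSK ?ord_predK.
Qed.

Lemma ordS4_fixed n (x : 'I_n) :
  2 < n -> ordS (ordS (ordS (ordS x))) = x -> n = 4.
Proof.
move=> n_gt2 /(congr1 val) /=; case: x => x xn /=.
rewrite !modS //; do ?case: ifP; lia.
Qed.

Section LowerBound.
Context {n : nat} (D : digraph 'I_n).
Hypotheses (n_gt2 : 2 < n) (oD : orientation (cycle_graph n) D).

Let adjE x y : underlying D x y = cycle_graph n x y.
Proof. by move/forallP/(_ x)/forallP/(_ y)/andP: oD => [/eqP]. Qed.

Lemma out_nbr_cycle v : out_nbr D v \subset [set ordS v; ord_pred v].
Proof.
apply/subsetP=> u; rewrite -cycle_graphP inE => vu.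
by rewrite -adjE /underlying /= vu.
Qed.

Lemma dominates_nbr v C c :
  dominates D v C -> c \in C -> v \in [set ordS c; ord_pred c].
Proof.
move=> vC cC; rewrite -cycle_graphP cycle_graph_sym cycle_graphP.
by apply: (subsetP (out_nbr_cycle v)); apply: (subsetP vC).
Qed.

Lemma card_dominators_le2 (C : {set 'I_n}) :
  C != set0 -> #|[set v | dominates D v C]| <= 2.
Proof.
case/set0Pn=> c cC.
apply: leq_trans (_ : #|[set ordS c; ord_pred c]| <= 2).
  by apply/subset_leq_card/subsetP=> v; rewrite inE => /dominates_nbr/(_ cC).
by rewrite cards2; case: eqP.
Qed.

(** If distinct [c], [d] in [C] had two common dominators [x], [y], then [c], [x], [d], [y] would
    close up into a 4-cycle, forcing [n = 4]. *)
Lemma card_dominated_add (v : 'I_n) (C : {set 'I_n}) :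
  n <> 4 -> C != set0 -> dominates D v C ->
  #|[set v | dominates D v C]| + #|C| <= 3.
Proof.
move=> n_neq4 C0 vC; have W2 := card_dominators_le2 C0.
have [C1|C_gt1] := leqP #|C| 1; first by lia.
have C2 : #|C| <= 2.
  apply: leq_trans (subset_leq_card (subset_trans vC (out_nbr_cycle v))) _.
  by rewrite cards2; case: eqP.
suff: #|[set v | dominates D v C]| <= 1 by lia.
apply/card_le1_eqP=> x y; rewrite !inE => xC yC.
have [c [d [cC dC /eqP cd]]] := card_gt1P C_gt1.
apply/eqP; apply: contra_notT n_neq4 => /eqP xy.
have := (dominates_nbr xC cC, dominates_nbr yC cC,
         dominates_nbr xC dC, dominates_nbr yC dC).
have predE (u w : 'I_n) : (u == ord_pred w) = (ordS u == w).
  by apply/eqP/eqP=> [->|<-]; rewrite ?ordSK ?ord_predK.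
have [Kc Kd] := (ordSK c, ordSK d); have [Kx Ky] := (ordSK x, ordSK y).
rewrite !inE !predE => -[[[]]].
(* Up to symmetry the only case left is [y = ordS c], [c = ordS x],
   [x = ordS d] and [d = ordS y]. *)
by do 4 (case/orP=> /eqP ?); first
  [ congruence | apply: (@ordS4_fixed n x n_gt2); congruence ].
Qed.

Lemma card_sinks : #|[set v | out_nbr D v == set0]| <= n./2.
Proof.
apply: card_independent_cycle => x y; rewrite !inE => /eqP x0 /eqP y0.
rewrite -adjE /underlying /=; apply/norP; split; apply/negP=> xy.
  by move/setP/(_ y): x0; rewrite !inE xy.
by move/setP/(_ x): y0; rewrite !inE xy.
Qed.

Variable P : {set {set 'I_n}}.
Hypothesis domP : dominator_coloring D P.

Lemma coloring_partition : partition P [set: 'I_n].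
Proof. by case/andP: domP => /andP[]. Qed.

Lemma color_class_neq0 C : C \in P -> C != set0.
Proof.
by case/and3P: coloring_partition => _ _ P0 PC; apply: contraNneq P0 => <-.
Qed.

Lemma card_color_class C : C \in P -> #|C| <= n./2.
Proof.
move=> PC; apply: card_independent_cycle => x y xC yC; rewrite -adjE.
case/andP: domP => /andP[_ /forall_inP/(_ C PC)/forall_inP/(_ x xC)].
by move/forall_inP/(_ y yC).
Qed.

Let Q := [set C in P | [exists v, dominates D v C]].
Let W C := [set v | dominates D v C].

Lemma sub_dominated_classes : Q \subset P.
Proof. by apply/subsetP=> C; rewrite inE => /andP[]. Qed.

(** The sets [W C] cover all non-sinks, and at most [n./2] vertices are sinks. *)
Lemma card_nonsinks : n <= \sum_(C in Q) #|W C| + n./2.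
Proof.
have := cardsC [set v | out_nbr D v == set0]; rewrite card_ord.
have := card_sinks; suff: #|~: [set v | out_nbr D v == set0]| <=
  \sum_(C in Q) #|W C| by lia.
apply: leq_trans (_ : #|\bigcup_(C in Q) W C| <= _).
  apply/subset_leq_card/subsetP=> v; rewrite !inE => v0.
  case/andP: domP => _ /forallP/(_ v)/implyP/(_ v0)/exists_inP[C PC vC].
  apply/bigcupP; exists C; rewrite !inE // PC /=.
  by apply/existsP; exists v.
elim/big_rec2: _ => [|C m U _ leUm]; first by rewrite cards0.
by apply: leq_trans (leq_card_setU _ _) _; rewrite leq_add2l.
Qed.

Lemma card_vertices (R : {set {set 'I_n}}) : R \subset P ->
  n <= \sum_(C in R) #|C| + #|P :\: R| * n./2.
Proof.
move=> RP; rewrite -[leqLHS]card_ord -cardsT (card_partition coloring_partition).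
rewrite (big_setID R) /= (setIidPr RP) leq_add2l -sum_nat_const.
by apply: leq_sum => C /setDP[/card_color_class].
Qed.

Lemma dominator_cycle_bounds : exists q r, [/\ #|P| = q + r,
  n <= (q + r) * n./2, n <= 2 * q + n./2 &
  n <> 4 -> 2 * n <= 3 * q + r.+1 * n./2].
Proof.
have QP := sub_dominated_classes.
have cardP : #|P| = #|Q| + #|P :\: Q| by rewrite -(cardsID Q P) (setIidPr QP).
exists #|Q|, #|P :\: Q|; split=> //.
- by have := card_vertices (sub0set P); rewrite big_set0 setD0 cardP.
- apply: leq_trans card_nonsinks _.
  rewrite leq_add2r mulnC -sum_nat_const; apply: leq_sum => C /(subsetP QP) PC.
  exact/card_dominators_le2/color_class_neq0.
(* Adding the two counts, the sinks and the [r] undominated classes contribute at most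
   [r.+1 * n./2]. *)
move=> n_neq4; rewrite mulSn; have := card_nonsinks; have := card_vertices QP.
suff: \sum_(C in Q) #|W C| + \sum_(C in Q) #|C| <= 3 * #|Q| by lia.
rewrite -big_split /= mulnC -sum_nat_const; apply: leq_sum => C.
rewrite inE => /andP[PC /existsP[v vC]].
exact: card_dominated_add n_neq4 (color_class_neq0 PC) vC.
Qed.

End LowerBound.

(** * Arithmetic and the exact values *)

Lemma chi_d_min_cycle_bounds n : 2 < n -> exists q r,
  [/\ chi_d_min (cycle_graph n) = q + r,
  n <= (q + r) * n./2, n <= 2 * q + n./2 &
  n <> 4 -> 2 * n <= 3 * q + r.+1 * n./2].
Proof.
move=> n_gt2.
have [||D oD ->] := @chi_d_min_attained _ (cycle_graph n).
- exact/cycle_graph_irr/ltnW.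
- exact: cycle_graph_sym.
have [x|P domP ->] := @chi_d_attained _ D; first exact: orientation_irr oD.
exact: dominator_cycle_bounds domP.
Qed.

Lemma chi_d_min_cycle_ge n k : 2 < n -> n <= 4 * k -> 4 * k <= n + 3 ->
  n <> 4 -> n <> 5 -> n <> 6 -> k + 2 <= chi_d_min (cycle_graph n).
Proof.
move=> n_gt2 n_le n_ge n4 n5 n6.
have [q [r [-> lo1 lo2 /(_ n4) lo3]]] := chi_d_min_cycle_bounds n_gt2.
(* For [r >= 2], [lo2] gives [q >= k]; smaller [r] needs the finer count [lo3]. *)
have [r_ge2|] := leqP 2 r; first by lia.
case: r => [|[|//]] in lo1 lo3 * => _; last by lia.
(* With [r = 0] and [n = 3], [lo3] gives only [q >= 2]; but classes are then singletons, so [lo1]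
   gives [q >= 3]. *)
have [n3|n_neq3] := eqVneq n 3; last by lia.
by subst n; rewrite /= in lo1; lia.
Qed.

Theorem theorem2 :
  [/\ chi_d_min (cycle_graph 4) = 2,
      chi_d_min (cycle_graph 5) = 3,
      chi_d_min (cycle_graph 6) = 3 &
      forall n k i : nat,
        3 <= n -> 0 < k -> i < 4 -> n = 4 * k - i ->
        n <> 4 -> n <> 5 -> n <> 6 ->
        chi_d_min (cycle_graph n) = k + 2].
Proof.
split.
- apply/eqP; rewrite eqn_leq chi_d_min_cycle4_le /=.
  by have [|q [r [-> /= lo _ _]]] := @chi_d_min_cycle_bounds 4; lia.
- apply/eqP; rewrite eqn_leq chi_d_min_cycle56_le //=.
  by have [|q [r [-> /= lo _ _]]] := @chi_d_min_cycle_bounds 5; lia.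
- apply/eqP; rewrite eqn_leq chi_d_min_cycle56_le //=.
  have [//|q [r [-> /= _ lo2 lo3]]] := @chi_d_min_cycle_bounds 6.
  (* Class sizes alone give only two classes here; this count forces [q + r >= 3]. *)
  have {lo3} : 12 <= 3 * q + r.+1 * 3 by apply: lo3.
  by case: r => [|[|r]]; lia.
move=> n k i n_gt2 k_gt0 i_lt4 nE n4 n5 n6.
by apply/eqP; rewrite eqn_leq chi_d_min_cycle_le ?chi_d_min_cycle_ge //; lia.
Qed.
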